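(* Let $k \geqslant 5$ be an integer. If $k$ is odd, then there is a graph which is in $B_{k}$ but not in $B_{2k-8}^{m}$. If $k$ is even, then there is a graph which is in $B_{k}$ but not in $B_{2k-9}^{m}$.
   Context: All graphs are finite and simple. A grid consists of horizontal grid lines (rows, increasing from bottom to top) and vertical grid lines (columns, increasing from left to right). A grid point is a crossing of two grid lines. A grid edge is the part of a grid line between two consecutive grid points. A path on a grid consists of two grid points (its end points) and a number of consecutive grid edges connecting them. A bend of a path is a turn of the path at a grid point. An EPG representation of a graph $G$ assigns to each vertex $v$ of $G$ a path $P_v$ on a common grid such that two distinct vertices $v,w$ are adjacent in $G$ if and only if $P_v$ and $P_w$ share at least one grid edge. A path is monotonic if it is ascending in both columns and rows, i.e. it has the shape of a staircase going upwards from left to right. For a nonnegative integer $k$, $B_k$ is the class of all graphs that have an EPG representation in which every path has at most $k$ bends. For a nonnegative integer $\ell$, $B_\ell^m$ (the superscript $m$ is just a symbol for ''monotonic'') is the class of all graphs that have an EPG representation in which every path is monotonic and has at most $\ell$ bends. *)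

(* Defs.v *)
From mathcomp Require Import all_boot.

Set Implicit Arguments.
Unset Strict Implicit.
Unset Printing Implicit Defensive.

Record sgraph := SGraph {
  vertex :> finType;
  adj : rel vertex;
  adj_sym : symmetric adj;
  adj_irrefl : irreflexive adj
}.

(* A point is (column, row).  The quadrant nat * nat contains every finite     *)
(* grid, and a representation of a finite graph only visits finitely many      *)
(* grid lines, so no bound on the grid is recorded.                            *)
Definition gpoint := (nat * nat)%type.

Definition horizontal_step (p q : gpoint) : bool :=
  (p.2 == q.2) && ((q.1 == p.1.+1) || (p.1 == q.1.+1)).

Definition vertical_step (p q : gpoint) : bool :=
  (p.1 == q.1) && ((q.2 == p.2.+1) || (p.2 == q.2.+1)).

Definition grid_step (p q : gpoint) : bool :=
  horizontal_step p q || vertical_step p q.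

(* The grid edge between two neighbouring points, as an unordered pair: the    *)
(* left (resp. lower) end comes first, whatever the order of p and q.          *)
Definition grid_edge (p q : gpoint) : gpoint * gpoint :=
  if p.1 + p.2 < q.1 + q.2 then (p, q) else (q, p).

(* A path is given by the grid points it visits in order from one end point    *)
(* to the other.                                                               *)
Definition path_edges (s : seq gpoint) : seq (gpoint * gpoint) :=
  [seq grid_edge u.1 u.2 | u <- zip s (behead s)].

(* Consecutive, pairwise distinct grid edges: a path may meet itself at a     *)
(* grid point, but it does not run twice through a grid edge; in particular it *)
(* never reverses direction.                                                   *)
Definition grid_path (s : seq gpoint) : bool :=
  [&& 1 < size s, sorted grid_step s & uniq (path_edges s)].

Fixpoint bends (s : seq gpoint) : nat :=
  if s is p :: s1 then
    (if s1 is q :: r :: _ then horizontal_step p q != horizontal_step q r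
     else false) + bends s1
  else 0.

Definition monotonic (s : seq gpoint) : bool :=
  sorted (fun p q : gpoint => (p.1 <= q.1) && (p.2 <= q.2)) s.

Definition share_edge (s t : seq gpoint) : Prop :=
  exists e, e \in path_edges s /\ e \in path_edges t.

Definition EPG_representation (G : sgraph) (P : G -> seq gpoint) : Prop :=
  (forall v, grid_path (P v)) /\
  (forall v w, v != w -> (adj v w <-> share_edge (P v) (P w))).

Definition in_B (k : nat) (G : sgraph) : Prop :=
  exists P : G -> seq gpoint,
    EPG_representation P /\ forall v, bends (P v) <= k.

Definition in_Bm (l : nat) (G : sgraph) : Prop :=
  exists P : G -> seq gpoint,
    EPG_representation P /\ forall v, monotonic (P v) /\ bends (P v) <= l.

(* Main.v *)
(* The graph is the intersection graph of N spirals with k bends and of many  *)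
(* staircases with k bends; those that matter meet k + 1 different spirals,   *)
(* one per leg.                                                               *)
(*                                                                            *)
(* In a monotonic representation of a graph in which every vertex b of an     *)
(* independent set B has m neighbours in an independent set A of N vertices,  *)
(* a path P_b with at most l bends must often step directly from one path of  *)
(* A to another one: a bend-free segment between two different paths of A is  *)
(* possible only where one of them ends or bends, and otherwise every step    *)
(* that costs just one bend happens at a crossing of two paths of A.  The     *)
(* total number of ends and bends of A is linear in N, and two monotonic      *)
(* paths with l bends cross at most l + 1 times; as each grid point serves at *)
(* most two of the paths P_b, this gives                                      *)
(*   (2 m - l - 2) |B| <= 4 N (l + 2) + N (N - 1) (l + 1).                    *)
(*                                                                            *)
(* Spirals are not subject to this bound: two of them cross about k^2 / 4     *)
(* times, and staircases that turn at nearly all of these crossings provide   *)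
(* about N^2 k / 4 vertices b with m = k + 1.  For l = 2 k - 8 and large N    *)
(* (here N = 3 r^2 with r = k / 2 + 1) this contradicts the inequality.  The  *)
(* same graph works for both parities of k.                                   *)

Require Import Defs.
From mathcomp Require Import all_boot.
From mathcomp Require Import zify.

Set Implicit Arguments.
Unset Strict Implicit.
Unset Printing Implicit Defensive.

(** Two counts are set against each other. In a monotonic representation, label each grid edge by
    the path of A that uses it. A path [P b] must collect at least [m] labels, and by [label_count]
    each new one costs 2, paid by bends of [P b] or by grid points where paths of A end, bend or
    cross. Monotonic paths cross rarely ([size_crossings]) and each grid point is charged at most
    twice, whence [monotonic_bound].

    In the construction, the crossings of two levels of spiral lines are cut into edge-disjoint
    diagonal staircases ([stair_index_inj]), each meeting [k.+1] spirals ([stair_degree]). For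
    [l = 2 * k - 8] the leading terms of the two counts balance, and the lower ones violate the
    bound ([count_too_large]). *)

(** * Directions and lines of a path *)

Definition edge_dir (e : gpoint * gpoint) : bool := horizontal_step e.1 e.2.

Definition edge_line (e : gpoint * gpoint) : bool * nat :=
  if edge_dir e then (true, e.1.2) else (false, e.1.1).

Fixpoint changes (d : seq bool) : nat :=
  if d is b :: d1 then (if d1 is b1 :: _ then b != b1 else false) + changes d1
  else 0.

Lemma edge_dir_grid_edge p q : edge_dir (grid_edge p q) = horizontal_step p q.
Proof.
rewrite /grid_edge; case: ifP => // _.
by rewrite /edge_dir /horizontal_step /= orbC eq_sym.
Qed.

Lemma path_edges_cons p q s :
  path_edges [:: p, q & s] = grid_edge p q :: path_edges (q :: s).
Proof. by []. Qed.

Lemma path_edges_cat s p t :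
  path_edges (rcons s p ++ t) = path_edges (rcons s p) ++ path_edges (p :: t).
Proof.
elim: s => [|q s IH]; first by [].
by case: s IH => [|q' s] IH //=; rewrite !path_edges_cons /= -IH.
Qed.

Lemma bendsE s : bends s = changes [seq edge_dir e | e <- path_edges s].
Proof.
elim: s => [|p [|q [|r s]] IH] //.
rewrite path_edges_cons map_cons.
have -> : bends [:: p, q, r & s] =
  (horizontal_step p q != horizontal_step q r) + bends [:: q, r & s] by [].
by rewrite IH !path_edges_cons !map_cons !edge_dir_grid_edge.
Qed.

Lemma size_undup_cons (T : eqType) (x : T) s :
  size (undup (x :: s)) <= (size (undup s)).+1.
Proof. by rewrite /=; case: ifP. Qed.

(** A new grid line is entered only at a bend, since consecutive edges of equal direction lie on one
    line. *)
Lemma size_lines s : sorted grid_step s ->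
  size (undup [seq edge_line e | e <- path_edges s]) <= (bends s).+1.
Proof.
elim: s => [|p [|q [|r s]] IH] //.
move=> srt.
have srt' : sorted grid_step [:: q, r & s] by case/andP: srt.
have -> : bends [:: p, q, r & s] =
  (horizontal_step p q != horizontal_step q r) + bends [:: q, r & s] by [].
have {IH srt'} := IH srt'; rewrite (path_edges_cons p) map_cons.
set L := map _ (path_edges [:: q, r & s]) => IH.
have [eq_d|_] := eqVneq; last first.
  by rewrite add1n; apply: leq_trans (size_undup_cons _ _) _; rewrite ltnS.
rewrite add0n; suff eL : edge_line (grid_edge p q) \in L.
  by have -> : undup (edge_line (grid_edge p q) :: L) = undup L by rewrite /= eL.
suff -> : edge_line (grid_edge p q) = edge_line (grid_edge q r).
  by rewrite /L path_edges_cons map_cons mem_head.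
rewrite /edge_line !edge_dir_grid_edge -eq_d.
move: srt => /= /and3P[]; rewrite /grid_step -eq_d.
case hpq: (horizontal_step p q) => /=.
  move=> _ _ _; move: (hpq); rewrite eq_d; move: hpq.
  rewrite /grid_edge /horizontal_step => /andP[/eqP e1 _] /andP[/eqP e2 _].
  by do 2 case: ifP => _ /=; congr (_, _); lia.
rewrite /vertical_step /grid_edge => /andP[/eqP e1 _] /andP[/eqP e2 _] _.
by do 2 case: ifP => _ /=; congr (_, _); lia.
Qed.

(** * Counting labels along a path *)

Section LabelCount.

Variables (X : Type) (T : eqType) (dir : X -> bool) (lab : X -> option T).

(** A new label has to cost 2: each bend pays 1 and the weight pays the rest. A detour over
    unlabelled edges needs no weight when it both begins and ends with a bend. *)
Definition switch_weight (e e' : X) : nat :=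
  if dir e == dir e' then 2 * (lab e != lab e')
  else [&& lab e != lab e', lab e & lab e'].

Fixpoint total_weight (E : seq X) : nat :=
  if E is e :: E1 then
    (if E1 is e' :: _ then switch_weight e e' else 0) + total_weight E1
  else 0.

Lemma label_count (E : seq X) :
  2 * size (undup (pmap lab E)) <= changes (map dir E) + total_weight E + 2.
Proof.
(* An unlabelled head saves 1: a label put before it later costs 2, but a *)
(* bend makes up for only 1.                                              *)
suff: 2 * size (undup (pmap lab E)) + (if E is e :: _ then ~~ lab e : nat else 0)
      <= changes (map dir E) + total_weight E + 2 by lia.
elim: E => [|e [|e' E] IH] //; first by rewrite /=; case: (lab e).
set S := pmap lab (e' :: E) in IH *.
have -> : pmap lab [:: e, e' & E] = if lab e is Some a then a :: S else S by [].
have -> : changes (map dir [:: e, e' & E]) =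
  (dir e != dir e') + changes (map dir (e' :: E)) by [].
have -> : total_weight [:: e, e' & E] =
  switch_weight e e' + total_weight (e' :: E) by [].
move: IH; set c := changes _; set w := total_weight _ => IH.
rewrite /switch_weight.
case le: (lab e) => [a|]; last first.
  by case: eqP => _; case: (lab e') IH => [a'|] /= IH; lia.
case le': (lab e') IH => [a'|] IH; last first.
  have := size_undup_cons a S.
  by case: eqP => _ /=; move: IH => /=; lia.
have [eqa | neq] := eqVneq (Some a) (Some a'); last first.
  have := size_undup_cons a S.
  by case: eqP => _ /=; move: IH => /=; lia.
have aS : a \in S by case: eqa => ->; rewrite /S /= le' mem_head.
have -> : undup (a :: S) = undup S by rewrite /= aS.
by case: eqP => _ /=; move: IH => /=; lia.
Qed.

End LabelCount.

(** * Monotonic representations *)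

Definition up_step (p q : gpoint) : bool :=
  (q == (p.1.+1, p.2)) || (q == (p.1, p.2.+1)).

Definition edge_out (b : bool) (z : gpoint) : gpoint * gpoint :=
  if b then (z, (z.1.+1, z.2)) else (z, (z.1, z.2.+1)).

(** At coordinate 0 the truncated predecessor gives a pair that is not an up-step, hence not an edge
    of a monotonic path. *)
Definition edge_in (b : bool) (z : gpoint) : gpoint * gpoint :=
  if b then ((z.1.-1, z.2), z) else ((z.1, z.2.-1), z).

Lemma up_stepE p q : up_step p q ->
  [/\ grid_edge p q = (p, q), edge_out (edge_dir (p, q)) p = (p, q) &
      edge_in (edge_dir (p, q)) q = (p, q)].
Proof.
rewrite /grid_edge /edge_dir /horizontal_step /edge_out /edge_in.
case: p => p1 p2; case/orP => /eqP ->; rewrite /= ?eqxx ?orTb ?andbT.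
  by rewrite addSn ltnSn.
by rewrite addnS ltnSn; case: eqP => //; lia.
Qed.

Lemma sorted_up_step s : grid_path s -> monotonic s -> sorted up_step s.
Proof.
case/and3P => _ + _; rewrite /monotonic; elim: s => [|p [|q s] IH] //.
move=> /andP[stp srt] /andP[le_pq mono]; apply/andP; split; last exact: IH.
case: p q stp le_pq {IH srt mono} => p1 p2 [q1 q2].
rewrite /grid_step /horizontal_step /vertical_step /up_step /= !xpair_eqE.
by lia.
Qed.

Lemma path_edges_upP s e : sorted up_step s -> e \in path_edges s ->
  [/\ up_step e.1 e.2, e.1 \in s & e.2 \in s].
Proof.
elim: s => [|p [|q s] IH] // /andP[stp srt].
rewrite path_edges_cons in_cons => /predU1P[->|/(IH srt)[? e1 e2]].
  by have [-> _ _] := up_stepE stp; rewrite /= !inE !eqxx !orbT.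
by split=> //; rewrite in_cons ?e1 ?e2 orbT.
Qed.

Lemma monotonic_comparable s p q : monotonic s -> p \in s -> q \in s ->
  (p.1 <= q.1) && (p.2 <= q.2) || (q.1 <= p.1) && (q.2 <= p.2).
Proof.
pose le (p q : gpoint) := (p.1 <= q.1) && (p.2 <= q.2).
have le_tr : transitive le by move=> ? ? ?; rewrite /le; lia.
rewrite /monotonic -/le; elim: s => [|x s IH] //= pth.
have /allP x_min := order_path_min le_tr pth.
rewrite !inE => /predU1P[->|ps] /predU1P[->|qs].
- by rewrite !leqnn.
- by rewrite [X in X || _](x_min _ qs).
- by rewrite [X in _ || X](x_min _ ps) orbT.
- exact: IH (path_sorted pth) ps qs.
Qed.

Fixpoint turns (s : seq gpoint) : seq gpoint :=
  if s is p :: s1 then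
    (if s1 is q :: r :: _ then
       if horizontal_step p q != horizontal_step q r then [:: q] else [::]
     else [::]) ++ turns s1
  else [::].

Definition corners (s : seq gpoint) : seq gpoint :=
  [:: head (0, 0) s, last (0, 0) s & turns s].

Lemma size_corners s : size (corners s) = (bends s).+2.
Proof.
rewrite /=; congr _.+2; elim: s => [|p [|q [|r s]] IH] //.
have -> : bends [:: p, q, r & s] =
  (horizontal_step p q != horizontal_step q r) + bends [:: q, r & s] by [].
have -> : turns [:: p, q, r & s] =
  (if horizontal_step p q != horizontal_step q r then [:: q] else [::]) ++
  turns [:: q, r & s] by [].
by rewrite size_cat IH; case: eqP.
Qed.

Lemma turns_cons2 p q r s : turns [:: p, q, r & s] =
  (if horizontal_step p q != horizontal_step q r then [:: q] else [::]) ++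
  turns [:: q, r & s].
Proof. by []. Qed.

Lemma turns_cons p s : {subset turns s <= turns (p :: s)}.
Proof. by move=> z zs /=; rewrite mem_cat zs orbT. Qed.

Lemma edge_continues_out s p z : sorted up_step s -> (p, z) \in path_edges s ->
  z \notin corners s -> edge_out (edge_dir (p, z)) z \in path_edges s.
Proof.
rewrite /corners => srt pz; rewrite inE negb_or => /andP[_].
elim: s srt pz => [|x [|y s] IH] // /andP[stp srt].
rewrite path_edges_cons in_cons => /predU1P[|pz].
  have [-> _ _] := up_stepE stp; case=> -> ->.
  case: s srt {IH} => [|w s]; first by rewrite !inE eqxx.
  case/andP=> stp' _; have [eyw out _] := up_stepE stp'.
  rewrite turns_cons2 inE negb_or mem_cat => /andP[_].
  case: eqP => [eq_d _|_]; last by rewrite mem_head.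
  rewrite !path_edges_cons eyw inE -[edge_dir _]/(horizontal_step x y) eq_d.
  by rewrite [edge_out _ _]out mem_head orbT.
rewrite inE negb_or => /andP[zl zt].
rewrite inE IH ?orbT // inE negb_or; apply/andP; split=> //.
by apply: contra zt; apply: turns_cons.
Qed.

Lemma edge_continues_in s z q : sorted up_step s -> (z, q) \in path_edges s ->
  z \notin corners s -> edge_in (edge_dir (z, q)) z \in path_edges s.
Proof.
move=> srt zq; rewrite 2!inE !negb_or => /and3P[zh _ zt].
(* The second alternative is needed for the induction; for the whole path it would make [z] the
   head, which is a corner. *)
suff [//|hd] : edge_in (edge_dir (z, q)) z \in path_edges s \/
               ohead (path_edges s) = Some (z, q).
  case: s srt zh hd {zq zt} => [|x [|y s]] // /andP[/up_stepE[e _ _] _].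
  by rewrite path_edges_cons e /= => + [xz]; rewrite xz eqxx.
elim: s srt zq {zh} zt => [|x [|y s] IH] // /andP[stp srt].
rewrite path_edges_cons in_cons => /predU1P[->|zq zt]; first by right.
left; rewrite in_cons; have [|->|] := IH srt zq; last 2 first.
- by rewrite orbT.
- case: s srt zt {IH zq} => [|w s] // /andP[stp' _].
  have [-> _ iny] := up_stepE stp; have [eyw _ _] := up_stepE stp'.
  rewrite turns_cons2 mem_cat negb_or path_edges_cons eyw /= => /andP[zt _] [yz wq].
  move: zt; rewrite -yz -wq.
  case: (_ =P horizontal_step y w) => [eq_d _|_]; last by rewrite inE eqxx.
  by rewrite -[edge_dir _]/(horizontal_step y w) -eq_d [edge_in _ _]iny eqxx.
- by apply: contra zt; apply: turns_cons.
Qed.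

Definition passes (b : bool) (s : seq gpoint) (z : gpoint) : bool :=
  (edge_in b z \in path_edges s) && (edge_out b z \in path_edges s).

Definition crossing (s t : seq gpoint) (z : gpoint) : bool :=
  passes true s z && passes false t z || passes false s z && passes true t z.

Definition crossings (s t : seq gpoint) : seq gpoint :=
  [seq z <- undup s | crossing s t z].

Lemma crossingC s t z : crossing s t z = crossing t s z.
Proof. by rewrite /crossing orbC andbC [X in _ || X]andbC. Qed.

Lemma edge_dir_out b z : edge_dir (edge_out b z) = b.
Proof.
by case: b; rewrite /edge_dir /horizontal_step /= ?eqxx //; case: eqP => //; lia.
Qed.

(* Since [t] is monotonic, it crosses a given grid line at most once, so the   *)
(* crossings lie on pairwise distinct lines of [s].                           *)
Lemma size_crossings s t : grid_path s -> monotonic s -> grid_path t ->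
  monotonic t -> size (crossings s t) <= (bends s).+1.
Proof.
move=> gs ms gt mt; have us := sorted_up_step gs ms; have ut := sorted_up_step gt mt.
have [_ srt _] := and3P gs; apply: leq_trans (size_lines srt).
pose line z := if passes true s z && passes false t z then (true, z.2) : bool * nat
               else (false, z.1).
rewrite -(size_map line); apply: uniq_leq_size.
  rewrite map_inj_in_uniq ?filter_uniq ?undup_uniq // => z z'.
  rewrite !mem_filter => /andP[cz _] /andP[cz' _].
  have in_t b w : passes b t w -> (edge_in b w).1 \in t /\ (edge_out b w).2 \in t.
    by case/andP=> /(path_edges_upP ut)[_ -> _] /(path_edges_upP ut)[_ _ ->].
  (* For two crossings on one line of [s], the point before either one on [t] is compared with the
     point after the other; this forces them to coincide. *)
  have cmp := monotonic_comparable mt.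
  case: z z' cz cz' => [x y] [x' y']; rewrite /crossing /line.
  case: ifP => /= [/andP[_ /in_t[a1 a2]] _|_ /andP[_ /in_t[a1 a2]]];
  case: ifP => /= [/andP[_ /in_t[b1 b2]] _|_ /andP[_ /in_t[b1 b2]]] [] // ?;
  subst; have := cmp _ _ a1 b2; have := cmp _ _ b1 a2; rewrite /= => c1 c2;
  congr (_, _); lia.
move=> _ /mapP[z + ->]; rewrite mem_filter mem_undup => /andP[cz _].
suff [b -> bz] : exists2 b, line z = edge_line (edge_out b z) & passes b s z.
  by rewrite mem_undup map_f //; case/andP: bz.
move: cz; rewrite /crossing /line /edge_line;
case: ifP => [/andP[sz _] _|_ /andP[sz _]].
  by exists true; rewrite ?edge_dir_out.
by exists false; rewrite ?edge_dir_out.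
Qed.

Lemma sum_ltn_const N c : \sum_(i < N) \sum_(j < N | j < i) c = 'C(N, 2) * c.
Proof.
rewrite -bin2_sum big_mkord big_distrl; apply: eq_bigr => i _ /=.
by rewrite -(big_ord_widen N (fun=> c) (ltnW (ltn_ord i))) sum_nat_const card_ord.
Qed.

Lemma size_flatten_map (I : Type) (T : Type) (F : I -> seq T) (r : seq I) :
  size (flatten (map F r)) = \sum_(i <- r) size (F i).
Proof. by rewrite size_flatten /shape -map_comp sumnE big_map. Qed.

Lemma uniq_flatten_map (I T : eqType) (F : I -> seq T) (r : seq I) :
  uniq r -> {in r, forall i, uniq (F i)} ->
  {in r &, forall i j x, x \in F i -> x \in F j -> i = j} ->
  uniq (flatten (map F r)).
Proof.
elim: r => [|i r IH] //= /andP[ir ur] uF disj.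
rewrite cat_uniq uF ?mem_head // IH //=; last 2 first.
- by move=> j jr; apply: uF; rewrite inE jr orbT.
- by move=> j k jr kr; apply: disj; rewrite inE ?jr ?kr orbT.
rewrite andbT; apply/hasPn => x /flatten_mapP[j jr xj].
apply/negP => xi; move: ir; rewrite (disj i j _ _ x) ?jr ?mem_head //.
by rewrite inE jr orbT.
Qed.

(** A grid point is entered by only two up-steps, from the left and from below. *)
Lemma count_targets (F : seq (gpoint * gpoint)) (L : seq gpoint) :
  uniq F -> {in F, forall e, up_step e.1 e.2} ->
  count (fun e => e.2 \in L) F <= 2 * size L.
Proof.
move=> uF upF; rewrite -size_filter.
have <- : size [seq edge_in b z | b <- [:: true; false], z <- L] = 2 * size L.
  by rewrite size_allpairs.
apply: uniq_leq_size; first exact: filter_uniq.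
case=> p z; rewrite mem_filter => /andP[zL /upF up].
have [_ _ in1] := up_stepE up; apply/allpairsP; exists (edge_dir (p, z), z).
by split=> //; case: edge_dir.
Qed.

(** * The double count *)

Section MonotonicBound.

Variables (G : sgraph) (N l m : nat) (f : 'I_N -> G) (B : {set G}).
Variable P : G -> seq gpoint.
Hypotheses (repP : EPG_representation P)
  (monoP : forall v, monotonic (P v) /\ bends (P v) <= l).
Hypotheses (f_inj : injective f) (indepA : forall i j, ~~ adj (f i) (f j)).
Hypotheses (indepB : {in B &, forall b c, ~~ adj b c})
  (degB : {in B, forall b, m <= #|[set i | adj b (f i)]|}).

Let lab (e : gpoint * gpoint) : option 'I_N :=
  [pick i | e \in path_edges (P (f i))].

Let up v : sorted up_step (P v).
Proof. by apply: sorted_up_step; [case: repP | case: (monoP v)]. Qed.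

(** Labels are unambiguous because A is independent: no grid edge lies on two of its paths. *)
Let labE i e : e \in path_edges (P (f i)) -> lab e = Some i.
Proof.
rewrite /lab => ei; case: pickP => [j ej|/(_ i)]; last by rewrite ei.
congr Some; apply/eqP; apply: contraNT (indepA j i) => neq.
by case: repP => _ ->; [exists e | rewrite inj_eq].
Qed.

Let labP e i : lab e = Some i -> e \in path_edges (P (f i)).
Proof. by rewrite /lab; case: pickP => // j ej [<-]. Qed.

Let all_corners := flatten [seq corners (P (f i)) | i <- enum 'I_N].

Let all_crossings := flatten [seq flatten
  [seq crossings (P (f i)) (P (f j)) | j <- [seq j : 'I_N <- enum 'I_N | j < i]]
  | i : 'I_N <- enum 'I_N].

Let size_all_corners : size all_corners <= N * l.+2.
Proof.
rewrite size_flatten_map big_enum -[X in X * _](card_ord N) -sum_nat_const.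
apply: leq_sum => i _; rewrite size_corners !ltnS.
by case: (monoP (f i)).
Qed.

Let size_all_crossings : size all_crossings <= 'C(N, 2) * l.+1.
Proof.
rewrite size_flatten_map big_enum -sum_ltn_const; apply: leq_sum => i _.
rewrite size_flatten_map big_filter big_enum_cond; apply: leq_sum => j _.
have [m1 b1] := monoP (f i); have [m2 _] := monoP (f j); have [gP _] := repP.
by apply: leq_trans (size_crossings _ m1 _ m2) _.
Qed.

Let crossing_in i j z : i != j -> crossing (P (f i)) (P (f j)) z ->
  z \in all_crossings.
Proof.
wlog ltji : i j / j < i => [th neq cz|_ cz].
  have [lt|lt|/val_inj eq] := ltngtP j i; first exact: th cz.
  - by apply: (th j i); rewrite // 1?eq_sym // crossingC.
  - by rewrite eq eqxx in neq.
apply/flatten_mapP; exists i; first exact: mem_enum.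
apply/flatten_mapP; exists j; first by rewrite mem_filter ltji mem_enum.
rewrite mem_filter cz mem_undup; case/orP: cz => /andP[/andP[+ _] _];
by move/(path_edges_upP (up _)) => [].
Qed.

Let corner_in i z : z \in corners (P (f i)) -> z \in all_corners.
Proof. by move=> zi; apply/flatten_mapP; exists i; rewrite ?mem_enum. Qed.

(** Away from corners, every path of A using one of the two edges runs straight through [z]. So a
    straight step keeps its label, and a bend between two labels takes place at a crossing. *)
Let switch_weight_le p z q : up_step p z -> up_step z q ->
  switch_weight edge_dir lab (p, z) (z, q) <=
  2 * (z \in all_corners) + (z \in all_crossings).
Proof.
move=> up1 up2.
have [zc|zNc] := boolP (z \in all_corners).
  rewrite muln1 (leq_trans _ (leq_addr _ _)) // /switch_weight.
  by case: ifP => _; [case: (_ != _) | case: [&& _, _ & _]].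
have notc i : z \notin corners (P (f i)) by apply: contra zNc; apply: corner_in.
have [_ _ in1] := up_stepE up1; have [_ out2 _] := up_stepE up2.
have out i : (p, z) \in path_edges (P (f i)) ->
    edge_out (edge_dir (p, z)) z \in path_edges (P (f i)).
  by move=> pz; apply: edge_continues_out.
have inn i : (z, q) \in path_edges (P (f i)) ->
    edge_in (edge_dir (z, q)) z \in path_edges (P (f i)).
  by move=> pz; apply: edge_continues_in.
rewrite /switch_weight; case: eqP => [eq_d | /eqP neq_d].
  suff -> : lab (p, z) = lab (z, q) by rewrite eqxx.
  case e1: (lab (p, z)) => [i|]; last case e2: (lab (z, q)) => [i|] //.
    by apply/esym/labE; rewrite -out2 -eq_d out // labP.
  by rewrite -e1; apply/labE; rewrite -in1 eq_d inn // labP.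
case e1: (lab (p, z)) => [i|]; last by rewrite andbF.
case e2: (lab (z, q)) => [j|]; last by rewrite !andbF.
have [->|neq] := eqVneq i j; first by rewrite eqxx.
rewrite (crossing_in neq) ?addn1 //; first by case: (_ != _).
have pi : passes (edge_dir (p, z)) (P (f i)) z.
  by rewrite /passes in1 out labP.
have pj : passes (edge_dir (z, q)) (P (f j)) z.
  by rewrite /passes out2 inn labP.
move: neq_d pi pj; rewrite /crossing.
by case: (edge_dir _); case: (edge_dir _) => // _ -> ->; rewrite ?orbT.
Qed.

Let total_weight_le v : total_weight edge_dir lab (path_edges (P v)) <=
  \sum_(e <- path_edges (P v)) (2 * (e.2 \in all_corners) + (e.2 \in all_crossings)).
Proof.
elim: (P v) (up v) => [|p [|q s] IH] // /andP[up1 srt].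
have {IH} := IH srt; rewrite (path_edges_cons p) big_cons.
case: s srt => [|r s] // /andP[up2 _].
rewrite path_edges_cons.
have [-> _ _] := up_stepE up1; have [-> _ _] := up_stepE up2.
by move=> IH; apply: leq_add => //; apply: switch_weight_le.
Qed.

Let labels_le v : v \in B ->
  2 * m <= l.+2 + total_weight edge_dir lab (path_edges (P v)).
Proof.
move=> vB; have := label_count edge_dir lab (path_edges (P v)).
rewrite -bendsE addn2 -!addSn; have [_ bl] := monoP v => lc.
suff le_m : m <= size (undup (pmap lab (path_edges (P v)))).
  apply: leq_trans (leq_mul (leqnn 2) le_m) (leq_trans lc _).
  by rewrite leq_add2r !ltnS.
apply: leq_trans (degB vB) _; rewrite cardE; apply: uniq_leq_size (enum_uniq _) _.
move=> i; rewrite mem_enum inE mem_undup => adj_vi.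
have neq : v != f i by apply: contraTneq adj_vi => ->; rewrite adj_irrefl.
case: repP => _ /(_ _ _ neq)[/(_ adj_vi)[e [ev ei]] _].
by rewrite -(mem_map (@Some_inj _)) (pmapS_filter) -(labE ei) map_f //
  mem_filter ev (labE ei).
Qed.

(** Sum [labels_le] over [B]. The paths of [B] are edge-disjoint, so by [count_targets] each corner
    and each crossing is charged at most twice. *)
Lemma monotonic_bound :
  2 * m * #|B| <= l.+2 * #|B| + 4 * N * l.+2 + N * N.-1 * l.+1.
Proof.
pose F := flatten [seq path_edges (P b) | b <- enum B].
have uF : uniq F.
  apply: uniq_flatten_map => [|b _|b c]; first exact: enum_uniq.
    by case: repP => /(_ b) /and3P[].
  rewrite !mem_enum => bB cB e eb ec; apply/eqP.
  apply: contraNT (indepB bB cB) => neq.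
  by case: repP => _ ->; first by exists e.
have upF : {in F, forall e, up_step e.1 e.2}.
  by move=> e /flatten_mapP[b _ /(path_edges_upP (up b))[]].
have := count_targets all_corners uF upF.
have := count_targets all_crossings uF upF.
have wF : \sum_(b in B) 2 * m <= \sum_(b in B) l.+2 +
    \sum_(e <- F) (2 * (e.2 \in all_corners) + (e.2 \in all_crossings)).
  rewrite big_flatten big_map big_enum -big_split; apply: leq_sum => b bB.
  by apply: leq_trans (labels_le bB) _; rewrite leq_add2l total_weight_le.
move: wF; rewrite !sum_nat_const big_split -big_distrr /=.
rewrite -!(big_mkcond (fun e => e.2 \in _) (fun=> 1)) /= !sum1_count.
set c1 := count _ F; set c2 := count _ F => le_sum le2 le1.
rewrite -[X in N * X]bin1 mul_bin_diag.
apply: leq_trans (_ : _ <= l.+2 * #|B| + (2 * c1 + c2)) _.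
  by rewrite mulnC [l.+2 * _]mulnC.
rewrite -addnA leq_add2l leq_add //.
  have := leq_trans le1 (leq_mul (leqnn 2) size_all_corners).
  move/(leq_mul (leqnn 2))/leq_trans; apply.
  by rewrite !mulnA.
by apply: leq_trans le2 _; rewrite -mulnA leq_mul.
Qed.

End MonotonicBound.

(** * Zigzag paths *)

Definition line_point (b : bool) (l z : nat) : gpoint :=
  if b then (l, z) else (z, l).

Definition line_edge (b : bool) (l z : nat) : gpoint * gpoint :=
  (line_point b l z, line_point b l z.+1).

(** The start [x] is omitted because it already ends the preceding leg. *)
Definition walk (x y : nat) : seq nat :=
  if x <= y then iota x.+1 (y - x) else rev (iota y (x - y)).

Definition walk_edges (x y : nat) : seq nat :=
  if x <= y then iota x (y - x) else rev (iota y (x - y)).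

Lemma line_edgeE b l z :
  [/\ grid_edge (line_point b l z) (line_point b l z.+1) = line_edge b l z,
      grid_edge (line_point b l z.+1) (line_point b l z) = line_edge b l z,
      grid_step (line_point b l z) (line_point b l z.+1) &
      grid_step (line_point b l z.+1) (line_point b l z)].
Proof.
rewrite /line_edge /line_point /grid_edge /grid_step /horizontal_step.
by rewrite /vertical_step; case: b => /=; split; try lia; case: ifP => //; lia.
Qed.

Lemma edge_dir_line b l z : edge_dir (line_edge b l z) = ~~ b.
Proof. by rewrite /edge_dir /horizontal_step; case: b => /=; lia. Qed.

Lemma edge_line_line b l z : edge_line (line_edge b l z) = (~~ b, l).
Proof. by rewrite /edge_line edge_dir_line; case: b. Qed.

Lemma line_edge_inj b l z b' l' z' : line_edge b l z = line_edge b' l' z' ->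
  [/\ b = b', l = l' & z = z'].
Proof.
move=> e; have := congr1 edge_line e; rewrite !edge_line_line => -[/negb_inj eb el].
by move: e; rewrite -eb -el; case: (b) => -[].
Qed.

Lemma mem_walk_edges x y z :
  (z \in walk_edges x y) = (minn x y <= z < maxn x y).
Proof. by rewrite /walk_edges; case: ifP => le_xy; rewrite ?mem_rev mem_iota; lia. Qed.

Lemma walkP b l x y : let s := map (line_point b l) (walk x y) in
  [/\ path grid_step (line_point b l x) s,
      last (line_point b l x) s = line_point b l y &
      path_edges (line_point b l x :: s) = map (line_edge b l) (walk_edges x y)].
Proof.
rewrite /walk /walk_edges; case: leqP => le_xy.
  have [d ->] : exists d, y = x + d by exists (y - x); lia.
  rewrite addKn; clear y le_xy.
  elim: d x => [|d IH] x; first by rewrite addn0.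
  have [pth lst edg] := IH x.+1; have [e _ stp _] := line_edgeE b l x.
  by rewrite addnS -addSn -lst /= stp pth; split=> //; rewrite path_edges_cons edg e.
have [d ->] : exists d, x = y + d by exists (x - y); lia.
rewrite addKn; clear x le_xy.
elim: d => [|d IH]; first by rewrite addn0.
have [pth lst edg] := IH; have [_ e _ stp] := line_edgeE b l (y + d).
rewrite -[d.+1]addn1 iotaD rev_cat /= addn1 addnS; split; first by rewrite /= stp.
  by rewrite -lst.
by rewrite path_edges_cons edg e.
Qed.

(* The successive legs run along column [u 1], row [u 2], column [u 3], ...;  *)
(* leg [t] spans from the previous line [u t.-1] to the next line [u t.+1].   *)
Definition zigzag (u : nat -> nat) (n : nat) : seq gpoint :=
  (u 1, u 0) :: flatten [seq map (line_point (odd t) (u t)) (walk (u t.-1) (u t.+1))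
                        | t <- iota 1 n].

Lemma flatten_map_iotaS (T : Type) (F : nat -> seq T) n :
  flatten (map F (iota 1 n.+1)) = flatten (map F (iota 1 n)) ++ F n.+1.
Proof. by rewrite -[in LHS](addn1 n) iotaD map_cat flatten_cat add1n /= cats0. Qed.

Lemma zigzagS u n : zigzag u n.+1 =
  zigzag u n ++ map (line_point (odd n.+1) (u n.+1)) (walk (u n) (u n.+2)).
Proof. by rewrite /zigzag flatten_map_iotaS. Qed.

Lemma last_zigzag u n p :
  last p (zigzag u n) = line_point (odd n.+1) (u n.+1) (u n).
Proof.
elim: n p => [|n IH] p //; rewrite zigzagS last_cat IH.
have [_ -> _] := walkP (odd n.+1) (u n.+1) (u n) (u n.+2).
by rewrite /line_point /=; case: odd.
Qed.

Lemma zigzag_rcons u n :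
  zigzag u n = rcons (belast (u 1, u 0) (behead (zigzag u n)))
                     (line_point (odd n.+1) (u n.+1) (u n)).
Proof. by rewrite -(last_zigzag u n (0, 0)) -lastI. Qed.

Lemma path_edges_zigzag u n : path_edges (zigzag u n) =
  flatten [seq map (line_edge (odd t) (u t)) (walk_edges (u t.-1) (u t.+1))
          | t <- iota 1 n].
Proof.
elim: n => [|n IH] //.
rewrite zigzagS zigzag_rcons path_edges_cat -zigzag_rcons IH.
have [_ _ ->] := walkP (odd n.+1) (u n.+1) (u n) (u n.+2).
by rewrite flatten_map_iotaS.
Qed.

Lemma mem_path_edges_zigzag u n e :
  reflect (exists t z, [/\ 0 < t <= n,
             minn (u t.-1) (u t.+1) <= z < maxn (u t.-1) (u t.+1) &
             e = line_edge (odd t) (u t) z])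
          (e \in path_edges (zigzag u n)).
Proof.
rewrite path_edges_zigzag; apply: (iffP flatten_mapP) => [[t]|[t [z [tn zt ->]]]].
  rewrite mem_iota => tn /mapP[z]; rewrite mem_walk_edges => zt ->.
  by exists t, z; split=> //; lia.
by exists t; rewrite ?mem_iota ?map_f ?mem_walk_edges //; lia.
Qed.

Lemma changes_cat d1 d2 : changes (d1 ++ d2) <= (changes d1 + changes d2).+1.
Proof.
elim: d1 => [|b [|b' d1] IH] //=; last by move: IH => /=; lia.
by case: (d2) => [|b' d] //=; case: (b != b'); lia.
Qed.

Lemma changes_nseq n b : changes (nseq n b) = 0.
Proof. by elim: n => [|[|n] IH] //=; rewrite eqxx. Qed.

Lemma bends_zigzag u n : bends (zigzag u n.+1) <= n.
Proof.
rewrite bendsE path_edges_zigzag.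
have dirs t : [seq edge_dir e | e <-
    map (line_edge (odd t) (u t)) (walk_edges (u t.-1) (u t.+1))]
    = nseq (size (walk_edges (u t.-1) (u t.+1))) (~~ odd t).
  by elim: (walk_edges _ _) => //= z s ->; rewrite edge_dir_line.
elim: n => [|n IH]; first by rewrite /= cats0 dirs changes_nseq.
rewrite flatten_map_iotaS map_cat (leq_trans (changes_cat _ _)) //.
by rewrite dirs changes_nseq addn0 ltnS.
Qed.

(** Different legs run along different lines, so no edge repeats; [u 0 != u 2] makes the first leg
    nonempty. *)
Lemma grid_path_zigzag u n : 0 < n -> u 0 != u 2 ->
  (forall t t', 0 < t <= n -> 0 < t' <= n -> odd t = odd t' ->
    u t = u t' -> t = t') ->
  grid_path (zigzag u n).
Proof.
move=> n_gt0 u02 u_inj; apply/and3P; split.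
- case: n n_gt0 {u_inj} => // n _ /=; rewrite size_cat size_map /walk.
  by case: ifP; rewrite ?size_rev size_iota; lia.
- elim: n {n_gt0 u_inj} => [|n IH] //; rewrite zigzagS.
  rewrite /zigzag [_ ++ _]/= [sorted _ _]/= cat_path -/(zigzag u n).
  have [pth _ _] := walkP (odd n.+1) (u n.+1) (u n) (u n.+2).
  have /= lst := last_zigzag u n (0, 0).
  by apply/andP; split=> //; rewrite lst.
rewrite path_edges_zigzag; apply: uniq_flatten_map; first exact: iota_uniq.
  move=> t _; rewrite map_inj_uniq => [|z z' /line_edge_inj[]//].
  by rewrite /walk_edges; case: ifP; rewrite ?rev_uniq iota_uniq.
move=> t t'; rewrite !mem_iota => tn tn' e /mapP[z _ ->] /mapP[z' _].
by case/line_edge_inj => ot ut _; apply: u_inj => //; lia.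
Qed.

(** * Spirals and staircases *)

Section Arrangement.

Variables (N C K : nat).
Hypotheses (N_gt0 : 0 < N) (ltKC : K.+1 * N < C).

(* Line [t] of the spiral with number [a]: the lines are at the bottom, right, *)
(* top and left for [t] congruent to 0, 1, 2 and 3 modulo 4.  With growing     *)
(* [t * N + a] the rows move outwards and the columns move inwards, so that    *)
(* any two corners of the same kind cross.                                     *)
Definition pos (t a : nat) : nat :=
  let i := t * N + a in
  match t %% 4 with 0 => C - i | 1 => 2 * C - i | 2 => C + i | _ => i end.

Lemma index_lt t a : t <= K -> a <= N -> t * N + a < C.
Proof.
move=> tK aN; apply: leq_ltn_trans ltKC.
by rewrite mulSn addnC leq_add // leq_mul2r tK orbT.
Qed.

(** With [a = N] allowed, level [t] touches level [t.+1]; levels congruent modulo 4 are too far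
    apart for this. *)
Lemma index_inj t t' a a' : t = t' %[mod 4] -> a <= N -> a' <= N ->
  t * N + a = t' * N + a' -> t = t' /\ a = a'.
Proof.
wlog le_tt' : t t' a a' / t <= t'.
  move=> th et aN aN' e; have [le|/ltnW le] := leqP t t'; first exact: th.
  by have [-> ->] := th _ _ _ _ le (esym et) aN' aN (esym e).
move=> et aN aN'; have [<- /addnI|neq] := eqVneq t t'; first by [].
have : (t + 4) * N <= t' * N by rewrite leq_mul2r; lia.
by rewrite mulnDl; lia.
Qed.

Lemma mod4_cases t : [\/ t %% 4 = 0, t %% 4 = 1, t %% 4 = 2 | t %% 4 = 3].
Proof.
by have := ltn_pmod t (isT : 0 < 4); case: (t %% 4) => [|[|[|[|]]]] //; constructor.
Qed.

Lemma pos_inj t t' a a' : t <= K -> t' <= K -> a <= N -> a' <= N ->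
  odd t = odd t' -> pos t a = pos t' a' -> t = t' /\ a = a'.
Proof.
move=> tK tK' aN aN' ot.
have lt := index_lt tK aN; have lt' := index_lt tK' aN'.
(* Bottom rows lie at or below [C]; this bound puts the top rows strictly above it. *)
have ge1 s b : s %% 4 = 2 -> N <= s * N + b.
  by move=> ?; apply: leq_trans (leq_addr _ _); rewrite leq_pmull //; lia.
have := @ge1 t a; have := @ge1 t' a'; rewrite /pos.
case: (mod4_cases t) => et; case: (mod4_cases t') => et'; rewrite et et' //=.
all: try by exfalso; move: ot et et'; clear; lia.
all: move=> g1 g2 e; try by apply: index_inj; rewrite ?et ?et' //; lia.
all: exfalso; lia.
Qed.

Lemma pos_step t a : t <= K -> a < N ->
  pos t a.+1 = (pos t a).+1 \/ pos t a = (pos t a.+1).+1.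
Proof.
move=> tK aN; have lt := index_lt tK aN.
by rewrite /pos addnS; case: (mod4_cases t) => -> /=; lia.
Qed.

Lemma min_pos_step_inj t t' a a' : t <= K -> t' <= K -> a < N -> a' < N ->
  odd t = odd t' ->
  minn (pos t a) (pos t a.+1) = minn (pos t' a') (pos t' a'.+1) -> t = t' /\ a = a'.
Proof.
move=> tK tK' aN aN' ot.
have lt := index_lt tK aN; have lt' := index_lt tK' aN'.
have ge1 s b : s %% 4 = 2 -> N <= s * N + b.
  by move=> ?; apply: leq_trans (leq_addr _ _); rewrite leq_pmull //; lia.
have := @ge1 t a; have := @ge1 t' a'; rewrite /pos !addnS.
case: (mod4_cases t) => et; case: (mod4_cases t') => et'; rewrite et et' //=.
all: try by exfalso; move: ot et et'; clear; lia.
all: move=> g1 g2 e; try by apply: index_inj; rewrite ?et ?et' //; lia.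
all: exfalso; lia.
Qed.

(** A sufficient condition for row [H] of spiral [a] to cross column [V] of spiral [c]: the column
    lies further in than both ends of the row. If [H = V.+1], it is on the side where the row
    begins, and comparing spiral numbers suffices. *)
Definition crosses (H a V c : nat) : bool :=
  (H.+1 * N + a <= V * N + c) || (H == V.+1) && (a <= c).

Lemma crosses_span H a V c : 0 < H -> 0 < V -> H < K -> V < K -> a <= N -> c <= N ->
  ~~ odd H -> odd V -> crosses H a V c ->
  (minn (pos H.-1 a) (pos H.+1 a) <= pos V c <= maxn (pos H.-1 a) (pos H.+1 a)) &&
  (minn (pos V.-1 c) (pos V.+1 c) <= pos H a <= maxn (pos V.-1 c) (pos V.+1 c)).
Proof.
case: H => // H _; case: V => // V _ HK VK aN cN oH oV; rewrite /crosses /=.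
have l1 := @index_lt H.+2 a HK aN; have l2 := @index_lt V.+2 c VK cN.
rewrite /pos; case: (mod4_cases H) oH => eH oH; try (by exfalso; lia).
all: have -> : H.+1 %% 4 = (H %% 4).+1 %% 4 by lia.
all: have -> : H.+2 %% 4 = (H %% 4).+2 %% 4 by lia.
all: case: (mod4_cases V) oV => eV oV; try (by exfalso; lia).
all: have -> : V.+1 %% 4 = (V %% 4).+1 %% 4 by lia.
all: have -> : V.+2 %% 4 = (V %% 4).+2 %% 4 by lia.
all: rewrite eH eV /=.
all: case/orP => [le|/andP[/eqP eHV le]]; try (by exfalso; lia).
all: try rewrite eHV.
all: rewrite !mulSn in l1 l2 le *; lia.
Qed.

End Arrangement.

Section Representation.

Variables (N C k : nat).
Hypotheses (N_gt0 : 0 < N) (ltKC : k.+3 * N < C).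

Local Notation pos := (pos N C).

Definition spiral (a : nat) : seq gpoint := zigzag (fun t => pos t a) k.+1.

Lemma spiral_grid_path a : a < N -> grid_path (spiral a).
Proof.
move=> aN; apply: grid_path_zigzag => // [|t t' tn tn' ot].
  by apply/eqP => /(pos_inj N_gt0 ltKC)[]; lia.
by case/(pos_inj N_gt0 ltKC) => //; lia.
Qed.

Lemma spirals_share a a' : a < N -> a' < N ->
  share_edge (spiral a) (spiral a') -> a = a'.
Proof.
move=> aN aN' [e [/mem_path_edges_zigzag[t [z [tn _ ->]]]]].
case/mem_path_edges_zigzag => t' [z' [tn' _ /line_edge_inj[ot + _]]].
by case/(pos_inj N_gt0 ltKC) => //; lia.
Qed.

Variable r : nat.
Hypothesis rE : r = k./2.+1.

Definition stair_line (H a V c s : nat) : nat :=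
  if odd s then pos V (c + s./2) else pos H (a + s./2).

(* A staircase turns at every grid point and alternates between lines of     *)
(* level [V] of the spirals [c, c + 1, ...] and lines of level [H] of the     *)
(* spirals [a + 1, a + 2, ...].                                              *)
Definition stair (H a V c : nat) : seq gpoint :=
  zigzag (stair_line H a V c) k.+1.

Definition stair_label (a c s : nat) : nat := (if odd s then c else a) + s./2.

Definition stair_ok (H a V c : nat) : bool :=
  [&& 0 < H <= k.+1, 0 < V <= k.+1, ~~ odd H, odd V, a + r < N & c + r <= N].

(** Lines of one level of consecutive spirals are neighbouring grid lines, so each leg is a single
    grid edge. *)
Lemma stair_legE H a V c s z : stair_ok H a V c -> 0 < s <= k.+1 ->
  let u := stair_line H a V c in
  (minn (u s.-1) (u s.+1) <= z < maxn (u s.-1) (u s.+1)) =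
  (z == if odd s then minn (pos H (a + s./2)) (pos H (a + s./2).+1)
        else minn (pos V (c + s./2.-1)) (pos V (c + s./2.-1).+1)).
Proof.
move=> ok sk /=; rewrite /stair_line.
case: s sk => // s sk; rewrite [s.+1.-1]/= !oddS negbK.
have -> : s.+2./2 = s./2.+1 by lia.
have /and5P[? ? ? ? /andP[? ?]] := ok; have sr : s./2 < r by lia.
case os: (odd s) => /=.
  have -> : uphalf s = s./2.+1 by lia.
  have := @pos_step N C k.+2 N_gt0 ltKC V (c + s./2); rewrite addnS /=; lia.
have -> : uphalf s = s./2 by lia.
have := @pos_step N C k.+2 N_gt0 ltKC H (a + s./2); rewrite addnS; lia.
Qed.

Lemma stair_grid_path H a V c : stair_ok H a V c -> grid_path (stair H a V c).
Proof.
move=> ok; have /and5P[? ? ? ? /andP[? ?]] := ok.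
apply: grid_path_zigzag => // [|t t' tn tn' ot]; rewrite /stair_line /=.
  by apply/eqP => /(pos_inj N_gt0 ltKC)[]; lia.
by rewrite ot; case: ifP => ot' /(pos_inj N_gt0 ltKC)[]; lia.
Qed.

(** The edge of a leg determines its own line and the two lines it joins, hence the levels and a
    common position on both diagonals. *)
Lemma stairs_share H a V c H' a' V' c' : stair_ok H a V c -> stair_ok H' a' V' c' ->
  share_edge (stair H a V c) (stair H' a' V' c') ->
  [/\ H = H', V = V' &
      exists i i', [/\ i < r, i' < r, a + i = a' + i' & c + i = c' + i']].
Proof.
move=> ok ok' [e [/mem_path_edges_zigzag[s [z [sk + ->]]]]].
rewrite stair_legE // => /eqP ->.
case/mem_path_edges_zigzag => s' [z' [sk' + /line_edge_inj[os + ez]]].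
rewrite stair_legE // -ez -os /stair_line -os => {z' ez}.
have /and5P[? ? ? ? /andP[? ?]] := ok; have /and5P[? ? ? ? /andP[? ?]] := ok'.
have sr : s./2 <= r by lia.
have sr' : s'./2 <= r by lia.
case: ifP os => os os' /eqP eqm /(pos_inj N_gt0 ltKC) eqp.
  have [|||||-> ac] := min_pos_step_inj N_gt0 ltKC _ _ _ _ _ eqm; try lia.
  have [|||||-> aa] := eqp; try lia.
  by split=> //; exists s./2, s'./2; split; lia.
have [|||||-> ac] := min_pos_step_inj N_gt0 ltKC _ _ _ _ _ eqm; try lia.
have [|||||-> aa] := eqp; try lia.
by split=> //; exists s./2.-1, s'./2.-1; split; lia.
Qed.

(** Both ends of the unit leg are crossings lying on the same leg of the spiral, which therefore
    contains the edge between them. *)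
Lemma stair_spiral_share H a V c s : stair_ok H a V c ->
  (forall i j, i <= r -> j <= r -> crosses N H (a + i) V (c + j)) ->
  0 < s <= k.+1 -> stair_label a c s < N ->
  share_edge (stair H a V c) (spiral (stair_label a c s)).
Proof.
move=> ok cr sk; rewrite /stair_label => lN.
have /and5P[? ? ? ? /andP[? ?]] := ok.
have span i j : i <= r -> j <= r ->
  (minn (pos H.-1 (a + i)) (pos H.+1 (a + i)) <= pos V (c + j) <=
   maxn (pos H.-1 (a + i)) (pos H.+1 (a + i))) &&
  (minn (pos V.-1 (c + j)) (pos V.+1 (c + j)) <= pos H (a + i) <=
   maxn (pos V.-1 (c + j)) (pos V.+1 (c + j))).
  move=> ir jr; apply: (crosses_span N_gt0 ltKC) (cr _ _ ir jr); lia.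
case os: (odd s) lN => lN.
  have sr : s./2 < r by lia.
  pose z := minn (pos H (a + s./2)) (pos H (a + s./2).+1).
  exists (line_edge true (pos V (c + s./2)) z); split; apply/mem_path_edges_zigzag.
    by exists s, z; rewrite stair_legE // os /stair_line os.
  exists V, z; rewrite (_ : odd V); last by lia.
  split=> //.
  have := span s./2 s./2; have := span s./2.+1 s./2.
  have := @pos_step N C k.+2 N_gt0 ltKC H (a + s./2); rewrite addnS /z; lia.
have [i si] : exists i, s./2 = i.+1 by exists s./2.-1; lia.
have sr : i < r by lia.
pose z := minn (pos V (c + i)) (pos V (c + i).+1).
exists (line_edge false (pos H (a + s./2)) z); split; apply/mem_path_edges_zigzag.
  by exists s, z; rewrite stair_legE // os /stair_line os si.
exists H, z; rewrite (_ : odd H = false); last by lia.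
split=> //; rewrite si; have := span i.+1 i; have := span i.+1 i.+1.
have := @pos_step N C k.+2 N_gt0 ltKC V (c + i); rewrite !addnS /z; lia.
Qed.

End Representation.

(** * The separating graph *)

Definition meets (s t : seq gpoint) : bool :=
  has [in path_edges t] (path_edges s).

Lemma meetsP s t : reflect (share_edge s t) (meets s t).
Proof. by apply: (iffP hasP) => [[e]|[e []]]; exists e. Qed.

Section IntersectionGraph.

Variables (V : finType) (P : V -> seq gpoint).

Definition meet_rel : rel V := [rel v w | (v != w) && meets (P v) (P w)].

Lemma meet_rel_sym : symmetric meet_rel.
Proof.
move=> v w; rewrite /meet_rel /= eq_sym; congr andb.
by apply/meetsP/meetsP => -[e [? ?]]; exists e.
Qed.

Lemma meet_rel_irrefl : irreflexive meet_rel.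
Proof. by move=> v; rewrite /meet_rel /= eqxx. Qed.

Definition intersection_graph : sgraph := SGraph meet_rel_sym meet_rel_irrefl.

Lemma intersection_graph_rep : (forall v, grid_path (P v)) ->
  @EPG_representation intersection_graph P.
Proof.
by move=> gP; split=> // v w neq; rewrite /adj /= /meet_rel /= neq; split=> /meetsP.
Qed.

End IntersectionGraph.

Lemma card_ltn_pairs n : #|[set y : 'I_n * 'I_n | y.1 < y.2]| = 'C(n, 2).
Proof.
rewrite -sum1_card -[RHS]muln1 -sum_ltn_const (exchange_big_dep xpredT) //=.
rewrite pair_big_dep.
by apply: eq_bigl => y; rewrite inE.
Qed.

Lemma block_inj r i i' q q' : i < r -> i' < r ->
  r * q + i = r * q' + i' -> q = q' /\ i = i'.
Proof.
move=> ir ir' e; have r_gt0 : 0 < r by lia.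
have := congr1 (divn^~ r) e; rewrite ![r * _]mulnC !divnMDl // !divn_small //.
by rewrite !addn0 => eq; split=> //; move: e; rewrite eq; lia.
Qed.

Section Separation.

Variables (k r M N : nat).
Hypotheses (k_ge5 : 5 <= k) (rE : r = k./2.+1) (ME : M = 3 * r) (NE : N = r * M).

Local Notation C := (k.+3 * N).+1.

(** The components are two level parameters, a shift of the diagonal by less than [r], and two
    blocks of [r] consecutive spirals. *)
Local Notation index := ('I_r.-1 * 'I_r * 'I_r * ('I_M.-1 * 'I_M.-1))%type.

(* If [v < h], the pair [(v, h.+1)] is used in place of [(h, v)]: the pairs   *)
(* with [h <= v] carry crossings for both orders of the blocks of spirals     *)
(* only if [h.+1 < v].                                                       *)
Definition level_H (x : index) : nat :=
  let: (h, v, _, _) := x in if h <= v then h.*2.+2 else v.*2.+2.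
Definition level_V (x : index) : nat :=
  let: (h, v, _, _) := x in if h <= v then v.*2.+1 else h.*2.+3.
Definition first_a (x : index) : nat :=
  let: (h, v, ga, (al, be)) := x in if h <= v then r * al + ga else r * be + ga.
Definition first_c (x : index) : nat :=
  let: (h, v, ga, (al, be)) := x in if h <= v then r * be.+1 else r * al.

Definition paths (w : 'I_N + index) : seq gpoint :=
  match w with
  | inl a => spiral N C k a
  | inr x => stair N C k (level_H x) (first_a x) (level_V x) (first_c x)
  end.

Local Notation G := (intersection_graph paths).

Definition stair_vertices : {set G} :=
  inr @: [set x : index | x.2.1 < x.2.2].

Let N_gt0 : 0 < N. Proof. by rewrite NE ME rE !muln_gt0. Qed.

Let ltNC : k.+3 * N < C. Proof. exact: ltnSn. Qed.

Let block_le (i : 'I_M.-1) : r * i.+2 <= N.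
Proof. by rewrite NE leq_mul2l; apply/orP; right; have := ltn_ord i; lia. Qed.

Lemma stair_index_ok x :
  stair_ok N k r (level_H x) (first_a x) (level_V x) (first_c x).
Proof.
case: x => [[[h v] ga] [al be]]; rewrite /stair_ok /=.
have := ltn_ord h; have := ltn_ord v; have := ltn_ord ga.
have := block_le al; have := block_le be; rewrite !mulnS => b1 b2 lga lv lh.
by case: (leqP h v) => hv; rewrite ?mulnS; apply/and5P; split; lia.
Qed.

Lemma stair_index_crosses (x : index) i j : x.2.1 < x.2.2 -> i <= r -> j <= r ->
  crosses N (level_H x) (first_a x + i) (level_V x) (first_c x + j).
Proof.
case: x => [[[h v] ga] [al be]] /= lt_ab ir jr; rewrite /crosses.
have lga := ltn_ord ga.
have : r * al.+2 <= r * be.+1 by rewrite leq_mul2l ltnS lt_ab orbT.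
have := block_le be.
rewrite !mulnS => b1 b2.
case: (leqP h v) => [|lt_vh].
  rewrite leq_eqVlt => /orP[/eqP eq_hv|lt_hv].
    by apply/orP; right; rewrite eq_hv eqxx /=; lia.
  apply/orP; left; have : h.*2.+3 * N <= v.*2.+1 * N by rewrite leq_mul2r; lia.
  by move: lt_hv; lia.
apply/orP; left.
(* Here the block of [a] lies above that of [c]; two spare levels make up for it. *)
have : v.*2.+3.+2 * N <= h.*2.+3 * N by rewrite leq_mul2r; lia.
by lia.
Qed.

Lemma paths_grid_path w : grid_path (paths w).
Proof.
case: w => [a|x] /=; first exact: (spiral_grid_path N_gt0 ltNC).
exact: (stair_grid_path N_gt0 ltNC rE (stair_index_ok x)).
Qed.

Lemma stair_index_inj (x y : index) : x.2.1 < x.2.2 -> y.2.1 < y.2.2 ->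
  share_edge (paths (inr x)) (paths (inr y)) -> x = y.
Proof.
move=> lx ly.
case/(stairs_share N_gt0 ltNC rE (stair_index_ok x) (stair_index_ok y)).
case: x y lx ly => [[[h v] ga] [al be]] [[[h' v'] ga'] [al' be']] /= lx ly.
have lga := ltn_ord ga; have lga' := ltn_ord ga'.
move=> eH eV [i [i' [ir ir' ea ec]]].
have block_eq b b' : i = i' -> r * b + ga + i = r * b' + ga' + i' ->
    b = b' /\ ga = ga' :> nat.
  by move=> -> /addIn; apply: block_inj.
move: eH eV; case: (leqP h v) ea ec => hv; case: (leqP h' v') => hv' ea;
  case/(block_inj ir ir') => ebl ei eH eV; have [eal ega] := block_eq _ _ ei ea.
- congr (_, _, _, (_, _)); apply: val_inj => //=; lia.
(* Indices of the two kinds may agree in levels, but then [al = be' > al' = be.+1 > al]. *)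
- exfalso; lia.
- exfalso; lia.
- congr (_, _, _, (_, _)); apply: val_inj => //=; lia.
Qed.

Lemma stair_index_disjoint (x : index) : x.2.1 < x.2.2 ->
  first_a x + r < first_c x \/ first_c x + r <= first_a x.
Proof.
case: x => [[[h v] ga] [al be]] /= lt_ab; have lga := ltn_ord ga.
have : r * al.+2 <= r * be.+1 by rewrite leq_mul2l ltnS lt_ab orbT.
rewrite !mulnS; case: (leqP h v) => _; [left | right]; rewrite ?mulnS; lia.
Qed.

Lemma in_B_G : in_B k G.
Proof.
exists paths; split; first exact: intersection_graph_rep paths_grid_path.
by case=> [a|x]; apply: bends_zigzag.
Qed.

Lemma card_stair_vertices : #|stair_vertices| = r.-1 * r * r * 'C(M.-1, 2).
Proof.
rewrite card_imset; last by move=> x y [].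
rewrite -card_ltn_pairs -[X in X * _](_ : #|[set: 'I_r.-1 * 'I_r * 'I_r]| = _).
  by rewrite -cardsX; apply: eq_card => x; rewrite !inE.
by rewrite cardsT !card_prod !card_ord.
Qed.

Lemma stair_degree w : w \in stair_vertices ->
  k.+1 <= #|[set a : 'I_N | @adj G w (inl a)]|.
Proof.
case/imsetP => x; rewrite inE => lx -> {w}.
pose lbl s := stair_label (first_a x) (first_c x) s.
have ok := stair_index_ok x; have /and5P[_ _ _ _ /andP[aN cN]] := ok.
have lblN (s : 'I_k.+1) : lbl s.+1 < N.
  by have := ltn_ord s; rewrite /lbl /stair_label; case: ifP; lia.
pose L s := Ordinal (lblN s).
have L_inj : injective L.
  move=> s s' /(congr1 val) /=; rewrite /lbl /stair_label.
  move=> e; apply: ord_inj; move: e (stair_index_disjoint lx).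
  have := ltn_ord s; have := ltn_ord s'.
  by case: ifP => os; case: ifP => os'; lia.
apply: leq_trans (_ : #|L @: setT| <= _).
  by rewrite card_imset // cardsT card_ord.
apply/subset_leq_card/subsetP => _ /imsetP[s _ ->]; rewrite inE; apply/meetsP.
apply: (stair_spiral_share N_gt0 ltNC rE ok) => //.
  by move=> i j; apply: stair_index_crosses.
by have := ltn_ord s.
Qed.

Lemma count_too_large (n := r.-1 * r * r * 'C(M.-1, 2)) :
  (2 * k - 8).+2 * n + 4 * N * (2 * k - 8).+2 + N * N.-1 * (2 * k - 8).+1 <
  2 * k.+1 * n.
Proof.
have [s eq_r] : exists s, r = s.+3 by exists (r - 3); lia.
have eqX : 2 * 'C(M.-1, 2) = (3 * s + 8) * (3 * s + 7).
  by rewrite -mul_bin_diag bin1 ME eq_r; congr (_ * _); lia.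
have eqN : N = s.+3 * s.+3 * 3 by rewrite NE ME eq_r; lia.
have eqn : 8 * n = s.+3 * s.+3 * (4 * s.+2 * ((3 * s + 8) * (3 * s + 7))).
  by rewrite -eqX /n eq_r; move: 'C(_, _) => X; rewrite /=; lia.
have eqk : 2 * k.+1 * n = (2 * k - 8).+2 * n + 8 * n.
  by rewrite -mulnDl; congr (_ * _); lia.
rewrite eqk -addnA ltn_add2l eqn.
(* For both parities [k <= 2 * s + 5], so [2 * k - 8 <= 4 * s + 2]. *)
apply: (@leq_ltn_trans (4 * N * (4 * s + 4) + N * N.-1 * (4 * s + 3))).
  by apply: leq_add; rewrite leq_mul2l; apply/orP; right; lia.
have -> : 4 * N * (4 * s + 4) + N * N.-1 * (4 * s + 3) =
  s.+3 * s.+3 * (3 * (4 * (4 * s + 4) + N.-1 * (4 * s + 3))).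
  by rewrite {1 2}eqN; move: N.-1 => N'; lia.
(* Both remaining cubics in [s] have leading coefficient 36; they differ by
   [9 * s * s + 62 * s + 166]. *)
rewrite ltn_pmul2l //.
have -> : N.-1 = 3 * s * s + 18 * s + 26 by rewrite eqN; lia.
by have := leq0n (s * s); lia.
Qed.

Lemma not_in_Bm_G : ~ in_Bm (2 * k - 8) G.
Proof.
case=> P [repP monoP].
pose f (a : 'I_N) : G := inl a.
have f_inj : injective f by move=> ? ? [].
have indepA (a b : 'I_N) : ~~ adj (f a) (f b).
  apply/negP => /andP[/eqP neq /meetsP sh]; apply: neq; congr inl; apply: val_inj.
  exact: (spirals_share N_gt0 ltNC) sh.
have indepB : {in stair_vertices &, forall b c, ~~ adj b c}.
  move=> _ _ /imsetP[x lx ->] /imsetP[y ly ->]; rewrite !inE in lx ly.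
  apply/negP => /andP[/eqP neq /meetsP sh]; apply: neq.
  by rewrite (stair_index_inj lx ly sh).
have := monotonic_bound repP monoP f_inj indepA indepB stair_degree.
by rewrite card_stair_vertices leqNgt count_too_large.
Qed.

End Separation.

Theorem theorem4p1 (k : nat) (hk : 5 <= k) :
  (odd k -> exists G : sgraph, in_B k G /\ ~ in_Bm (2 * k - 8) G) /\
  (~~ odd k -> exists G : sgraph, in_B k G /\ ~ in_Bm (2 * k - 9) G).
Proof.
have [G [inB ninBm]] : exists G : sgraph, in_B k G /\ ~ in_Bm (2 * k - 8) G.
  pose r := k./2.+1; pose M := 3 * r; pose N := r * M.
  have rE : r = k./2.+1 by []; have ME : M = 3 * r by []; have NE : N = r * M by [].
  exists (intersection_graph (@paths k r M N)).
  by split; [apply: in_B_G hk rE ME NE | apply: not_in_Bm_G hk rE ME NE].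
(* One graph serves both parities, as a bound of [2 * k - 9] bends implies one of [2 * k - 8]. *)
split=> _; exists G; split=> //; case=> P [repP monoP]; apply: ninBm.
exists P; split=> // v; have [mono le_bends] := monoP v; split=> //.
by apply: leq_trans le_bends _; lia.
Qed.
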